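(* The set $\{S_B : B \in \mathcal{S}^3 \text{ singular and indefinite}\}$ is equal to the set of all second-order cone representable (socr) slices of $\mathcal{S}_+^3$ of dimension $5$.
   Context: $\mathcal{S}^k$ denotes the vector space of real symmetric $k \times k$ matrices, with the trace scalar product $\langle A, B\rangle := \operatorname{tr}(AB)$, and $\mathcal{S}_+^k \subseteq \mathcal{S}^k$ the cone of symmetric positive semidefinite matrices. A matrix $B \in \mathcal{S}^k$ is indefinite if it is neither positive semidefinite nor negative semidefinite. For a real vector space $V$ and a convex cone $C \subseteq V$, a set $S \subseteq C$ is a slice of $C$ if $S$ is the intersection of $C$ and a linear subspace of $V$. The dimension of a slice is the dimension of its linear hull. For $B \in \mathcal{S}^k$, $S_B := \{A \in \mathcal{S}_+^k : \langle A, B\rangle = 0\}$ (here $k=3$). A set $S$ has a $C$-lift if $S$ is the image of a slice of $C$ under a linear map. Let $\mathcal{Q} := \{x \in \mathbb{R}^3 : x_3 \ge \sqrt{x_1^2 + x_2^2}\}$ be the three-dimensional Lorentz cone and $\mathcal{Q}^m := \mathcal{Q} \times \cdots \times \mathcal{Q}$ ($m$ factors), a convex cone in $(\mathbb{R}^3)^m$. A closed convex cone is second-order cone representable (socr) if it has a $\mathcal{Q}^m$-lift for some positive integer $m$. *)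

(* Defs.v *)
From HB Require Import structures.
From mathcomp Require Import all_boot all_order all_algebra.
From mathcomp Require Import all_classical all_reals all_analysis.

Set Implicit Arguments.
Unset Strict Implicit.
Unset Printing Implicit Defensive.

Import Order.TTheory GRing.Theory Num.Theory.
Import numFieldNormedType.Exports.

Local Open Scope classical_set_scope.
Local Open Scope ring_scope.

Definition symv (R : realType) (k : nat) : {vspace 'M[R]_k} :=
  fixedSpace (linfun (@trmx R k k)).

Lemma symvP (R : realType) (k : nat) (A : 'M[R]_k) :
  reflect (A^T = A) (A \in symv R k).
Proof. by apply: (iffP fixedSpaceP); rewrite lfunE. Qed.

(* [symmx R k] is a vector space in its own right: its subspaces are of type
   [{vspace symmx R k}], and [vsval] is its inclusion into ['M[R]_k]. *)
Notation symmx R k := (subvs_of (symv R k)).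

Definition scalar_prod (R : realType) (k : nat) (A B : symmx R k) : R :=
  \tr (vsval A *m vsval B).

Definition is_psd (R : realType) (k : nat) (A : symmx R k) : Prop :=
  forall x : 'cV[R]_k, 0 <= (x^T *m vsval A *m x) 0 0.

Definition is_nsd (R : realType) (k : nat) (A : symmx R k) : Prop :=
  forall x : 'cV[R]_k, (x^T *m vsval A *m x) 0 0 <= 0.

Definition indefinite (R : realType) (k : nat) (B : symmx R k) : Prop :=
  ~ is_psd B /\ ~ is_nsd B.

Definition singular (R : realType) (k : nat) (B : symmx R k) : Prop :=
  vsval B \notin unitmx.

Definition psd_cone (R : realType) (k : nat) : set (symmx R k) :=
  [set A | is_psd A].

Definition psd_orth (R : realType) (k : nat) (B : symmx R k) :
    set (symmx R k) :=
  [set A | psd_cone A /\ scalar_prod A B = 0].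

Definition is_slice (R : realType) (V : vectType R) (C S : set V) : Prop :=
  exists L : {vspace V}, S = C `&` [set` L].

Definition is_linear_hull (R : realType) (V : vectType R) (S : set V)
    (U : {vspace V}) : Prop :=
  S `<=` [set` U] /\
  forall W : {vspace V}, S `<=` [set` W] -> (U <= W)%VS.

Definition has_dim (R : realType) (V : vectType R) (S : set V) (d : nat) :
    Prop :=
  exists2 U : {vspace V}, is_linear_hull S U & \dim U = d.

Definition has_lift (R : realType) (V W : vectType R) (C : set V)
    (S : set W) : Prop :=
  exists2 T : set V, is_slice C T & exists f : 'Hom(V, W), S = f @` T.

Definition lorentz_cone (R : realType) : set 'rV[R]_3 :=
  [set x | Num.sqrt (x 0 0 ^+ 2 + x 0 1 ^+ 2) <= x 0 2].

Definition lorentz_pow (R : realType) (m : nat) :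
    set {ffun 'I_m -> 'rV[R]_3} :=
  [set x | forall i, lorentz_cone (x i)].
Arguments lorentz_pow : clear implicits.

Definition convex_cone (R : realType) (V : vectType R) (S : set V) : Prop :=
  S !=set0 /\
  forall (a b : R) (x y : V),
    0 <= a -> 0 <= b -> S x -> S y -> S (a *: x + b *: y).

(* A [vectType] carries no topology.  Closedness refers to the usual topology of
   a finite-dimensional real vector space, read off in the coordinates [v2r];
   it does not depend on the choice of coordinates. *)
Definition closed_vect (R : realType) (V : vectType R) (S : set V) : Prop :=
  closed [set VectorInternalTheory.v2r x | x in S].

Definition is_socr (R : realType) (V : vectType R) (S : set V) : Prop :=
  [/\ convex_cone S, closed_vect S &
    exists2 m : nat, (0 < m)%N & has_lift (lorentz_pow R m) S].

(* Main.v *)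
Require Import Defs.
From HB Require Import structures.
From mathcomp Require Import all_boot all_order all_algebra.
From mathcomp Require Import all_classical all_reals all_analysis.
From mathcomp Require Import ring lra.

Set Implicit Arguments.
Unset Strict Implicit.
Unset Printing Implicit Defensive.

Import Order.TTheory GRing.Theory Num.Theory.
Import numFieldNormedType.Exports.
Import VectorInternalTheory.

Local Open Scope classical_set_scope.
Local Open Scope ring_scope.

(** Let [B] be indefinite.  Choosing two [B]-isotropic vectors in a plane on
    which [B] takes both signs, together with a vector [B]-orthogonal to them,
    gives an invertible [P] with [P^T *m B *m P = hyperb c], the matrix of the
    quadratic form [2 * x0 * x1 + c * x2 ^+ 2]
    ([indefinite_normal_form]), and [B] is singular exactly when [c = 0].  The
    substitution [A = P *m N *m P^T] turns [<A, B> = 0] into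
    [2 * N01 + c * N22 = 0].

    If [c = 0], the slice consists of the positive semidefinite matrices [N]
    with [N01 = 0].  The nonzero pattern of such a matrix is a path, so
    splitting the middle entry [N22] writes [N] as a sum of two positive
    semidefinite [2 x 2] blocks ([psdmx_arrow_split]).  Each block ranges over
    a copy of the Lorentz cone, so the slice is a linear image of the product
    of two of them ([singular_lift]).  Five rank-one matrices of the slice span
    the orthogonal complement of [B] ([singular_hull]), hence the dimension.

    If [c != 0], the isotropic vectors contain the conic
    [v t = P *m (1, - c / 2 * t ^+ 2, t)^T], no three points of which are
    linearly dependent, and the matrices [v t *m (v t)^T] lie in the slice.
    Suppose that the slice is a linear image of a linear section of a power of
    the Lorentz cone, and lift these matrices for infinitely many [t].  In each
    factor the lifts fall into faces of the cone; by the infinite pigeonhole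
    principle, applied once per factor, one can pass to infinitely many [t]
    for which, in each factor, the lifts lie all in the relative interior of
    one face or in those of pairwise distinct nonzero faces.  In both cases the
    sum of two lifts dominates a small positive multiple of a third, because
    points of two distinct nonzero faces of the Lorentz cone add up to an
    interior point.  Mapping down, some
    [v r *m (v r)^T + v s *m (v s)^T - e *: v t *m (v t)^T] with [e > 0] is
    positive semidefinite, which fails on a vector orthogonal to [v r] and
    [v s] but not to [v t] ([nonsingular_no_lift]).  Working with lifts of
    points only, this argument needs no conic duality.

    It remains to see that a slice of dimension 5 is the slice of some
    indefinite [B].  The symmetric [3 x 3] matrices have dimension 6, so the
    hull of the slice is the orthogonal complement of some nonzero [B].  If
    [B] were semidefinite, all [A] in the slice would annihilate the range of
    [B] and the hull would have dimension at most 3 ([psd_hull_dim]). *)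

(** * Symmetric bilinear forms *)

Definition bform (R : realType) (k : nat) (M : 'M[R]_k) (x y : 'cV[R]_k) : R :=
  (x^T *m M *m y) 0 0.

Definition psdmx (R : realType) (k : nat) (M : 'M[R]_k) : Prop :=
  forall x, 0 <= bform M x x.

Section Forms.
Variables (R : realType) (k : nat).
Implicit Types (M N : 'M[R]_k) (x y z : 'cV[R]_k) (a b : R).

Lemma bformDl M x y z : bform M (x + y) z = bform M x z + bform M y z.
Proof. by rewrite /bform linearD !mulmxDl mxE. Qed.

Lemma bformDr M x y z : bform M x (y + z) = bform M x y + bform M x z.
Proof. by rewrite /bform mulmxDr mxE. Qed.

Lemma bformZl M a x y : bform M (a *: x) y = a * bform M x y.
Proof. by rewrite /bform linearZ -!scalemxAl mxE. Qed.

Lemma bformZr M a x y : bform M x (a *: y) = a * bform M x y.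
Proof. by rewrite /bform -scalemxAr mxE. Qed.

Lemma bformDm M N x y : bform (M + N) x y = bform M x y + bform N x y.
Proof. by rewrite /bform mulmxDr mulmxDl mxE. Qed.

Lemma bformZm M a x y : bform (a *: M) x y = a * bform M x y.
Proof. by rewrite /bform -scalemxAr -scalemxAl mxE. Qed.

Lemma bform_sym M x y : M^T = M -> bform M x y = bform M y x.
Proof.
move=> sM; transitivity ((x^T *m M *m y)^T 0 0); first by rewrite mxE.
rewrite /bform; congr (_ _ _).
by rewrite !trmx_mul trmxK sM mulmxA.
Qed.

Lemma bform_quad M x y a b : M^T = M ->
  bform M (a *: x + b *: y) (a *: x + b *: y) =
  bform M x x * a ^+ 2 + 2 * bform M x y * a * b + bform M y y * b ^+ 2.
Proof.
move=> sM; rewrite !(bformDl, bformDr, bformZl, bformZr) (bform_sym y x) //.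
ring.
Qed.

Lemma bform_congr (n : nat) (P : 'M[R]_(n, k)) (M : 'M[R]_n) x y :
  bform (P^T *m M *m P) x y = bform M (P *m x) (P *m y).
Proof. by rewrite /bform trmx_mul !mulmxA. Qed.

Lemma bform_rank1 (v x y : 'cV[R]_k) :
  bform (v *m v^T) x y = (x^T *m v) 0 0 * (y^T *m v) 0 0.
Proof.
rewrite /bform mulmxA -mulmxA mxE big_ord1; congr (_ * _).
by rewrite -[y]trmxK -trmx_mul mxE trmxK.
Qed.

Lemma mxtrace_rank1 (v : 'cV[R]_k) M : \tr (v *m v^T *m M) = bform M v v.
Proof. by rewrite -mulmxA mxtrace_mulC /bform /mxtrace big_ord1. Qed.

Lemma psdmx_rank1 (v : 'cV[R]_k) : psdmx (v *m v^T).
Proof. by move=> x; rewrite bform_rank1 -expr2 sqr_ge0. Qed.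

Lemma psdmx_comb M N a b :
  0 <= a -> 0 <= b -> psdmx M -> psdmx N -> psdmx (a *: M + b *: N).
Proof.
by move=> a0 b0 pM pN x; rewrite bformDm !bformZm addr_ge0 // mulr_ge0.
Qed.

End Forms.

Lemma mxtrace_congr (R : realType) (k : nat) (P N B : 'M[R]_k) :
  \tr (P *m N *m P^T *m B) = \tr (N *m (P^T *m B *m P)).
Proof. by rewrite -!mulmxA mxtrace_mulC !mulmxA. Qed.

Lemma mulmx_congrK (R : realType) (k : nat) (P M : 'M[R]_k) : P \in unitmx ->
  M = P *m (invmx P *m M *m (invmx P)^T) *m P^T.
Proof.
move=> uP; rewrite !mulmxA mulmxV // mul1mx -mulmxA -trmx_mul mulmxV //.
by rewrite trmx1 mulmx1.
Qed.

Lemma quad_ge0 (R : realType) (a b c : R) :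
  (forall s t, 0 <= a * s ^+ 2 + 2 * b * s * t + c * t ^+ 2) ->
  [/\ 0 <= a, 0 <= c & b ^+ 2 <= a * c].
Proof.
move=> h.
have a0 : 0 <= a by have := h 1 0; lra.
have c0 : 0 <= c by have := h 0 1; lra.
split=> //.
have [ap|] := ltP 0 a.
  have := h (- b) a.
  have -> : a * (- b) ^+ 2 + 2 * b * - b * a + c * a ^+ 2 =
            a * (a * c - b ^+ 2) by ring.
  by rewrite pmulr_rge0 // subr_ge0.
move=> a0'; have az : a = 0 by apply/eqP; rewrite eq_le a0 a0'.
rewrite az mul0r; have [->|bn] := eqVneq b 0; first by rewrite expr0n.
(* With [a = 0] the form is affine in [s]; this [s] makes it equal to [-1]. *)
have := h (- ((c + 1) / (2 * b))) 1.
have -> : a * (- ((c + 1) / (2 * b))) ^+ 2 + 2 * b * - ((c + 1) / (2 * b)) * 1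
          + c * 1 ^+ 2 = -1 by rewrite az; field.
by rewrite oppr_ge0 ler10.
Qed.

Lemma quad_form_ge0 (R : realType) (a b c s t : R) : 0 <= a -> 0 <= c -> b ^+ 2 <= a * c ->
  0 <= a * s ^+ 2 + 2 * b * s * t + c * t ^+ 2.
Proof.
move=> a0 c0 h; have [az|an] := eqVneq a 0.
  move: h; rewrite az mul0r => h.
  have -> : b = 0 by apply/eqP; rewrite -sqrf_eq0 eq_le h sqr_ge0.
  by rewrite mulr0 !mul0r !add0r mulr_ge0 ?sqr_ge0.
have ap : 0 < a by rewrite lt_neqAle eq_sym an.
rewrite -(pmulr_rge0 _ ap).
have -> : a * (a * s ^+ 2 + 2 * b * s * t + c * t ^+ 2) =
  (a * s + b * t) ^+ 2 + (a * c - b ^+ 2) * t ^+ 2 by ring.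
by rewrite addr_ge0 ?sqr_ge0 // mulr_ge0 ?sqr_ge0 // subr_ge0.
Qed.

(** * Positive semidefinite matrices *)

Section PsdMatrices.
Variables (R : realType) (k : nat).
Implicit Types (M C A : 'M[R]_k) (p q x y : 'cV[R]_k).

Lemma bform_delta M x i : bform M (delta_mx i 0) x = (M *m x) i 0.
Proof. by rewrite /bform trmx_delta -mulmxA -rowE mxE. Qed.

Lemma bform_delta2 M i j : bform M (delta_mx i 0) (delta_mx j 0) = M i j.
Proof. by rewrite bform_delta -colE mxE. Qed.

Lemma psdmx_cauchy_schwarz M x y : M^T = M -> psdmx M ->
  bform M x y ^+ 2 <= bform M x x * bform M y y.
Proof.
move=> sM pM; have [] // := @quad_ge0 R (bform M x x) (bform M x y) (bform M y y).
by move=> s t; rewrite -bform_quad.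
Qed.

(** By Cauchy-Schwarz [q] is orthogonal to every vector for the form [M]. *)
Lemma psdmx_ker M q : M^T = M -> psdmx M -> bform M q q = 0 -> M *m q = 0.
Proof.
move=> sM pM q0; apply/colP => i; rewrite [RHS]mxE -bform_delta.
have := psdmx_cauchy_schwarz (delta_mx i 0) q sM pM.
by rewrite q0 mulr0 => h; apply/eqP; rewrite -sqrf_eq0 eq_le h sqr_ge0.
Qed.

(** Schur complement of [p]: what is left of the form [M] after splitting off
    the square of the linear form [bform M p].  If [bform M p p = 0] then the
    inverse is [0], so nothing is split off; the lemmas below need no case
    distinction on this. *)
Definition deflate M p : 'M[R]_k :=
  M - (bform M p p)^-1 *: ((M *m p) *m (M *m p)^T).

Lemma deflate_sym M p : M^T = M -> (deflate M p)^T = deflate M p.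
Proof.
by move=> sM; rewrite /deflate linearB linearZ /= trmx_mul trmxK sM.
Qed.

Lemma bform_deflate M p x : M^T = M ->
  bform (deflate M p) x x = bform M x x - (bform M p p)^-1 * bform M x p ^+ 2.
Proof.
move=> sM; rewrite bformDm -scaleNr bformZm bform_rank1 mulNr -expr2.
by rewrite mulmxA.
Qed.

Lemma psdmx_deflate M p : M^T = M -> psdmx M -> psdmx (deflate M p).
Proof.
move=> sM pM x; rewrite bform_deflate // subr_ge0.
have [->|p0] := eqVneq (bform M p p) 0; first by rewrite invr0 mul0r.
have pp : 0 < bform M p p by rewrite lt_neqAle eq_sym p0 pM.
by rewrite mulrC ler_pdivrMr // psdmx_cauchy_schwarz.
Qed.

Lemma mxtrace_deflate M C p :
  \tr (M *m C) =
  \tr (deflate M p *m C) + (bform M p p)^-1 * bform C (M *m p) (M *m p).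
Proof.
rewrite /deflate mulmxBl linearB /= -scalemxAl linearZ /= mxtrace_rank1.
by rewrite subrK.
Qed.

(** The positive semidefinite cone is contained in its dual.  Deflating [M] at a
    basis vector with nonzero diagonal entry splits off a multiple of a
    rank-one matrix [v *m v^T], whose trace product with [C] is [bform C v v],
    and lowers the number of nonzero diagonal entries. *)
Lemma psdmx_mxtrace_ge0 M C :
  M^T = M -> psdmx M -> psdmx C -> 0 <= \tr (M *m C).
Proof.
move=> + + pC; have [n] := ubnP #|[pred i | M i i != 0]|.
elim: n M => // n IH M + sM pM; rewrite ltnS => le_n.
have [i Mii|M0] := pickP [pred i | M i i != 0]; last first.
  suff -> : M = 0 by rewrite mul0mx linear0.
  apply/matrixP => i j; rewrite mxE.
  have := psdmx_cauchy_schwarz (delta_mx i 0) (delta_mx j 0) sM pM.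
  have /negbFE/eqP Mi0 := M0 i.
  rewrite !bform_delta2 Mi0 mul0r => h.
  by apply/eqP; rewrite -sqrf_eq0 eq_le h sqr_ge0.
rewrite (mxtrace_deflate _ _ (delta_mx i 0)) addr_ge0 //; last first.
  by rewrite mulr_ge0 ?invr_ge0.
apply: IH; [|exact: deflate_sym|exact: psdmx_deflate].
apply: leq_trans le_n; apply: proper_card; apply/properP; split; last first.
  exists i => //; rewrite inE negbK.
  rewrite -bform_delta2 bform_deflate // bform_delta2.
  by rewrite expr2 mulrA mulVf // mul1r subrr.
apply/fintype.subsetP => j; rewrite !inE; apply: contra => /eqP Mjj.
have := psdmx_deflate (delta_mx i 0) sM pM (delta_mx j 0).
rewrite -(bform_delta2 (deflate _ _)) bform_deflate // !bform_delta2 Mjj sub0r.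
rewrite oppr_ge0 oppr_eq0 => h; rewrite eq_le h /=.
by rewrite mulr_ge0 ?sqr_ge0 // invr_ge0 -bform_delta2.
Qed.

(** Splitting the square of [bform C p] off [C] writes [\tr (A *m C)] as a sum
    of two nonnegative terms, one of them a positive multiple of the value of
    the form [A] at [C *m p]. *)
Lemma psdmx_orth_ker A C p : A^T = A -> C^T = C -> psdmx A -> psdmx C ->
  0 < bform C p p -> \tr (A *m C) = 0 -> A *m (C *m p) = 0.
Proof.
move=> sA sC pA pC pp; rewrite mxtrace_mulC (mxtrace_deflate _ _ p) => t0.
apply: psdmx_ker => //; apply/eqP; rewrite eq_le pA andbT.
have h1 : 0 <= \tr (deflate C p *m A).
  by apply: psdmx_mxtrace_ge0 => //; [exact: deflate_sym|exact: psdmx_deflate].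
have : (bform C p p)^-1 * bform A (C *m p) (C *m p) <= 0 by lra.
by rewrite pmulr_rle0 ?invr_gt0.
Qed.

End PsdMatrices.

(** * Normal form of an indefinite ternary form *)

Lemma sum3 (V : nmodType) (F : 'I_3 -> V) : \sum_i F i = F 0 + F 1 + F 2.
Proof.
by rewrite !big_ord_recr big_ord0 /= add0r; do 2?[congr (_ + _)]; congr F;
   apply: val_inj.
Qed.

Lemma ord3P (i : 'I_3) : [\/ i = 0, i = 1 | i = 2].
Proof.
by case: i => [[|[|[|//]]] h]; [apply: Or31|apply: Or32|apply: Or33];
   apply: val_inj.
Qed.

Lemma nonunit_kernel (F : fieldType) (n : nat) (M : 'M[F]_n) (x : 'cV[F]_n) :
  x != 0 -> M *m x = 0 -> M \notin unitmx.
Proof.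
move=> x0 Mx; apply: contra x0 => uM.
by rewrite -(mulKmx uM x) Mx mulmx0.
Qed.

Lemma unitmx_inj (F : fieldType) (n : nat) (M : 'M[F]_n) :
  (forall x : 'cV[F]_n, M *m x = 0 -> x = 0) -> M \in unitmx.
Proof.
move=> inj; rewrite -unitmx_tr -row_free_unit -kermx_eq0.
apply/eqP/row_matrixP => i; rewrite row0; apply: trmx_inj; rewrite trmx0.
by apply: inj; rewrite -{1}[M]trmxK -trmx_mul -row_mul mulmx_ker row0 trmx0.
Qed.

Section NormalForm.
Variable R : realType.
Implicit Types (B P : 'M[R]_3) (x y u w z : 'cV[R]_3) (c : R).

(** Gram matrix of the quadratic form [2 * x0 * x1 + c * x2 ^+ 2]. *)
Definition hyperb c : 'M[R]_3 :=
  delta_mx 0 1 + delta_mx 1 0 + c *: delta_mx 2 2.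

Lemma bform_mx_delta x y i j : bform (delta_mx i j) x y = x i 0 * y j 0.
Proof.
by rewrite /bform -(mul_delta_mx (0 : 'I_1)) mulmxA -colE -mulmxA -rowE
           mxE big_ord1 !mxE.
Qed.

Lemma bform_hyperb c x y :
  bform (hyperb c) x y = x 0 0 * y 1 0 + x 1 0 * y 0 0 + c * (x 2 0 * y 2 0).
Proof. by rewrite !bformDm bformZm !bform_mx_delta. Qed.

Lemma mxtrace_hyperb c (A : 'M[R]_3) :
  \tr (A *m hyperb c) = A 1 0 + A 0 1 + c * A 2 2.
Proof.
have tr_delta i j : \tr (A *m delta_mx i j) = A j i.
  rewrite -(mul_delta_mx (0 : 'I_1)) mulmxA mxtrace_mulC mulmxA -rowE -colE.
  by rewrite /mxtrace big_ord1 !mxE.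
by rewrite !mulmxDr !linearD /= -scalemxAr linearZ /= !tr_delta.
Qed.

Lemma hyperb_unit c : (hyperb c \in unitmx) = (c != 0).
Proof.
have hE d x i : (hyperb d *m x) i 0 = bform (hyperb d) (delta_mx i 0) x.
  by rewrite bform_delta.
apply/idP/idP; last first.
  move=> c0; apply: unitmx_inj => x hx.
  have e i : bform (hyperb c) (delta_mx i 0) x = 0 by rewrite -hE hx mxE.
  move: (e 0) (e 1) (e 2); rewrite !bform_hyperb !mxE /=.
  rewrite !(mul0r, mul1r, addr0, add0r, mulr0) => x1 x0 /eqP.
  rewrite mulf_eq0 (negbTE c0) => /eqP x2.
  by apply/colP => i; rewrite mxE; case: (ord3P i) => ->.
apply: contraTneq => ->; apply: (@nonunit_kernel _ _ _ (delta_mx 2 0)).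
  by apply/eqP => /matrixP/(_ 2 0); rewrite !mxE /=; apply/eqP/oner_neq0.
apply/colP => i; rewrite hE bform_hyperb !mxE /=.
by rewrite !(mul0r, mulr0, addr0).
Qed.

(** On the plane of [p] and [q] the form is indefinite, so its discriminant is
    positive and it has two real isotropic lines. *)
Lemma isotropic_pair (n : nat) (B : 'M[R]_n) (p q : 'cV[R]_n) : B^T = B ->
    0 < bform B p p -> bform B q q < 0 ->
  exists (u w : 'cV[R]_n), [/\ bform B u u = 0, bform B w w = 0 & bform B u w = 1].
Proof.
move=> sB; set a := bform B p p; set g := bform B q q; set b := bform B p q.
move=> a0 g0; have D0 : 0 < b ^+ 2 - a * g by nra.
pose s := Num.sqrt (b ^+ 2 - a * g).
have s2 : s ^+ 2 = b ^+ 2 - a * g by rewrite sqr_sqrtr // ltW.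
pose l := 2 * g * (a * g - b ^+ 2).
have l0 : l != 0.
  have Dn : a * g - b ^+ 2 < 0 by lra.
  by rewrite /l mulf_neq0 ?(lt_eqF Dn) // mulf_neq0 ?(lt_eqF g0) ?pnatr_eq0.
(* The roots of [a + 2 b t + g t ^+ 2] are [(- b + s) / g] and [(- b - s) / g];
   [l] is the value of the form on the two isotropic vectors. *)
exists (g *: p + (s - b) *: q), (l^-1 *: (g *: p + (- s - b) *: q)).
rewrite !bformZr !bformZl !bform_quad // -/a -/b -/g.
split.
- have -> : a * g ^+ 2 + 2 * b * g * (s - b) + g * (s - b) ^+ 2 =
     g * (a * g - b ^+ 2 + s ^+ 2) by ring.
  by rewrite s2; ring.
- have -> : a * g ^+ 2 + 2 * b * g * (- s - b) + g * (- s - b) ^+ 2 =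
     g * (a * g - b ^+ 2 + s ^+ 2) by ring.
  by rewrite s2; ring.
- rewrite !(bformDl, bformDr, bformZl, bformZr) (bform_sym q p) // -/a -/b -/g.
  transitivity (l^-1 * (g * (a * g - b ^+ 2 - s ^+ 2))); first by ring.
  rewrite s2; have -> : g * (a * g - b ^+ 2 - (b ^+ 2 - a * g)) = l.
    by rewrite /l; ring.
  by rewrite mulVf.
Qed.

Lemma bform_common_orth B u w : exists2 z, z != 0 &
  bform B u z = 0 /\ bform B w z = 0.
Proof.
pose N := row_mx (B^T *m u) (B^T *m w) : 'M[R]_(3, 1 + 1).
have : kermx N != 0.
  by rewrite -mxrank_eq0 mxrank_ker subn_eq0 -ltnNge ltnS rank_leq_col.
case/rowV0Pn => v /sub_kermxP; rewrite mul_mx_row -row_mx0 => /eq_row_mx [hu hw] v0.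
exists v^T; first by rewrite -trmx_eq0 trmxK.
by split; [move: hu|move: hw] => /(congr1 trmx);
   rewrite !trmx_mul trmxK trmx0 /bform => ->; rewrite mxE.
Qed.

Lemma indefinite_normal_form B p q : B^T = B ->
    0 < bform B p p -> bform B q q < 0 ->
  exists2 P, P \in unitmx & exists c, P^T *m B *m P = hyperb c.
Proof.
move=> sB pp qq; have [u [w [uu ww uw]]] := isotropic_pair sB pp qq.
have [z z0 [uz wz]] := bform_common_orth B u w.
(* Pairing with [w] and [u] isolates the coordinates along [u] and [w], so
   [u], [w], [z] form a basis even when [z] lies in the radical of [B]. *)
have wu : bform B w u = 1 by rewrite bform_sym.
have zu : bform B z u = 0 by rewrite bform_sym.
have zw : bform B z w = 0 by rewrite bform_sym.
pose P : 'M[R]_3 := \matrix_(i, j) [:: u i 0; w i 0; z i 0]`_j.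
have P0 : col 0 P = u by apply/colP => i; rewrite !mxE.
have P1 : col 1 P = w by apply/colP => i; rewrite !mxE.
have P2 : col 2 P = z by apply/colP => i; rewrite !mxE.
exists P.
  apply: unitmx_inj => x; have -> : P *m x = x 0 0 *: u + x 1 0 *: w + x 2 0 *: z.
    by apply/colP => i; rewrite mxE sum3 !mxE /= ![_ * x _ _]mulrC.
  move=> x0; have e y : bform B y (x 0 0 *: u + x 1 0 *: w + x 2 0 *: z) = 0.
    by rewrite x0 /bform mulmx0 mxE.
  have := e u; have := e w; rewrite !(bformDr, bformZr) uu ww uw wu uz wz.
  rewrite !(mulr0, mulr1, add0r, addr0) => xx0 xx1.
  move/eqP: x0; rewrite xx0 xx1 !scale0r !add0r scaler_eq0 (negbTE z0) orbF.
  move=> /eqP xx2.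
  by apply/colP => i; rewrite [RHS]mxE; case: (ord3P i) => ->.
exists (bform B z z); apply/matrixP => i j.
rewrite -[LHS]bform_delta2 bform_congr -!colE -[RHS]bform_delta2 bform_hyperb.
by case: (ord3P i) => ->; case: (ord3P j) => ->; rewrite ?(P0, P1, P2) !mxE /=
   ?(uu, ww, uw, wu, uz, wz, zu, zw) !(mulr0, mulr1, add0r, addr0).
Qed.

Lemma normal_form_unit B P c : P \in unitmx -> P^T *m B *m P = hyperb c ->
  (B \in unitmx) = (c != 0).
Proof.
by move=> uP e; rewrite -hyperb_unit -e !unitmx_mul unitmx_tr uP /= andbT.
Qed.

End NormalForm.

(** * Faces of the Lorentz cone *)

Section Lorentz.
Variable R : realType.
Implicit Types (x y z : 'rV[R]_3).

(** The Lorentzian quadratic form and, below, its polarization. *)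
Definition lorentz_disc x : R := x 0 2 ^+ 2 - x 0 0 ^+ 2 - x 0 1 ^+ 2.
Definition lorentz_dot x y : R := x 0 2 * y 0 2 - x 0 0 * y 0 0 - x 0 1 * y 0 1.

Lemma lorentzP x : lorentz_cone x <-> 0 <= x 0 2 /\ 0 <= lorentz_disc x.
Proof.
rewrite /lorentz_cone /lorentz_disc /=.
have n0 : 0 <= x 0 0 ^+ 2 + x 0 1 ^+ 2 by rewrite addr_ge0 ?sqr_ge0.
split=> [h|[x20 h]].
  have x20 : 0 <= x 0 2 by apply: le_trans h; apply: sqrtr_ge0.
  split=> //; have := sqr_sqrtr n0; have := sqrtr_ge0 (x 0 0 ^+ 2 + x 0 1 ^+ 2).
  by nra.
by rewrite -[leRHS]ger0_norm // -sqrtr_sqr ler_sqrt ?sqr_ge0 //; lra.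
Qed.

Lemma lorentz_disc_comb a b x y : lorentz_disc (a *: x + b *: y) =
  a ^+ 2 * lorentz_disc x + 2 * (a * b) * lorentz_dot x y
  + b ^+ 2 * lorentz_disc y.
Proof. by rewrite /lorentz_disc /lorentz_dot !mxE; ring. Qed.

Lemma lorentz0 x : lorentz_cone x -> x 0 2 = 0 -> x = 0.
Proof.
move=> /lorentzP[_]; rewrite /lorentz_disc => + x2; rewrite x2 => h.
have h0 : 0 <= x 0 0 ^+ 2 by apply: sqr_ge0.
have h1 : 0 <= x 0 1 ^+ 2 by apply: sqr_ge0.
apply/rowP => i; rewrite mxE; case: (ord3P i) => -> //; apply/eqP;
  rewrite -sqrf_eq0; apply/eqP; lra.
Qed.

(** Reversed Cauchy-Schwarz inequality with explicit remainder: on the cone all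
    summands on the right are nonnegative, and they vanish together only if
    [x] and [y] are proportional. *)
Lemma lorentz_dotE x y :
  2 * (x 0 2 * y 0 2) * lorentz_dot x y =
  (x 0 0 * y 0 2 - y 0 0 * x 0 2) ^+ 2 + (x 0 1 * y 0 2 - y 0 1 * x 0 2) ^+ 2
  + y 0 2 ^+ 2 * lorentz_disc x + x 0 2 ^+ 2 * lorentz_disc y.
Proof. by rewrite /lorentz_disc /lorentz_dot; ring. Qed.

Lemma lorentz_dot_ge0 x y :
  lorentz_cone x -> lorentz_cone y -> 0 <= lorentz_dot x y.
Proof.
move=> qx qy; have /lorentzP[x2 dx] := qx; have /lorentzP[y2 dy] := qy.
have [x20|x20] := eqVneq (x 0 2) 0.
  by rewrite (lorentz0 qx x20) /lorentz_dot !mxE !mul0r !subr0.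
have [y20|y20] := eqVneq (y 0 2) 0.
  by rewrite (lorentz0 qy y20) /lorentz_dot !mxE !mulr0 !subr0.
have xy : 0 < 2 * (x 0 2 * y 0 2).
  by rewrite !mulr_gt0 // lt_neqAle eq_sym ?x20 ?y20.
rewrite -(pmulr_rge0 _ xy) lorentz_dotE.
by rewrite !addr_ge0 ?sqr_ge0 // mulr_ge0 ?sqr_ge0.
Qed.

Lemma lorentz_comb a b x y : 0 <= a -> 0 <= b ->
  lorentz_cone x -> lorentz_cone y -> lorentz_cone (a *: x + b *: y).
Proof.
move=> a0 b0 qx qy; have /lorentzP[x2 dx] := qx; have /lorentzP[y2 dy] := qy.
apply/lorentzP; split; first by rewrite !mxE addr_ge0 ?mulr_ge0.
rewrite lorentz_disc_comb; have xy := lorentz_dot_ge0 qx qy.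
by rewrite !addr_ge0 // !mulr_ge0.
Qed.

Lemma lorentzD x y : lorentz_cone x -> lorentz_cone y -> lorentz_cone (x + y).
Proof. by rewrite -[x in x + y]scale1r -[y in _ + y]scale1r; apply: lorentz_comb. Qed.

(** [y] lies in the smallest face of the cone that contains [x]. *)
Definition face_le y x := exists2 e : R, 0 < e & lorentz_cone (x - e *: y).

Lemma face_leDr y x z : lorentz_cone z -> face_le y x -> face_le y (x + z).
Proof. by move=> qz [e e0 h]; exists e => //; rewrite addrAC; exact: lorentzD. Qed.

Lemma face_le_interior x y : lorentz_cone x -> lorentz_cone y ->
  0 < lorentz_disc x -> face_le y x.
Proof.
move=> qx qy dx; have /lorentzP[x2 _] := qx; have /lorentzP[y2 dy] := qy.
have xy0 : 0 <= x 0 2 * y 0 2 by rewrite mulr_ge0.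
have xy : lorentz_dot x y <= 2 * (x 0 2 * y 0 2).
  (* Reflect [x] in the axis of the cone. *)
  have : 0 <= lorentz_dot (\row_i (if i == 2 then x 0 i else - x 0 i)) y.
    apply: lorentz_dot_ge0 => //; apply/lorentzP.
    rewrite /lorentz_disc !mxE /= !sqrrN; split=> //; exact: ltW.
  by rewrite /lorentz_dot !mxE /=; lra.
(* Subtracting [e *: y] lowers the Lorentzian form of [x] by at most
   [e * (4 * (x 0 2 * y 0 2))]; the summand 1 keeps [d] positive. *)
pose d := 4 * (x 0 2 * y 0 2) + 1.
have d0 : 0 < d by rewrite /d; lra.
exists (lorentz_disc x / d); first by rewrite divr_gt0.
set e := lorentz_disc x / d.
have e0 : 0 <= e by rewrite divr_ge0 // ltW.
have ed : e * d = lorentz_disc x by rewrite /e mulfVK // gt_eqF.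
apply/lorentzP; split.
  rewrite !mxE subr_ge0 -(ler_pM2r d0) mulrAC ed.
  have : lorentz_disc x <= x 0 2 ^+ 2.
    by rewrite /lorentz_disc -addrA gerDl -opprD oppr_le0 addr_ge0 ?sqr_ge0.
  move=> h; apply: (@le_trans _ _ (x 0 2 ^+ 2 * y 0 2)).
    by rewrite ler_wpM2r.
  rewrite /d expr2 -mulrA mulrDr mulr1.
  have : 0 <= x 0 2 * (x 0 2 * y 0 2) by rewrite mulr_ge0.
  by lra.
rewrite -scaleNr -[x in x + _]scale1r lorentz_disc_comb expr1n !mul1r.
have : 0 <= (- e) ^+ 2 * lorentz_disc y by rewrite mulr_ge0 ?sqr_ge0.
have : 2 * e * lorentz_dot x y <= e * d.
  by rewrite [2 * e]mulrC -mulrA ler_wpM2l // /d; lra.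
by lra.
Qed.

(** The face having [x] in its relative interior: [None] is the whole cone, a
    ray is represented by its point at height 1, and, since [0^-1 = 0], the
    face [0] by the zero vector. *)
Definition face_label x : option 'rV[R]_3 :=
  if 0 < lorentz_disc x then None else Some ((x 0 2)^-1 *: x).

Lemma face_label_eq x y : lorentz_cone x -> lorentz_cone y ->
  face_label x = face_label y -> face_le y x.
Proof.
move=> qx qy; rewrite /face_label.
case: ltP => dx; first by case: ltP => // dy _; apply: face_le_interior.
case: ltP => // dy [e].
have [y20|y20] := eqVneq (y 0 2) 0.
  by exists 1 => //; rewrite (lorentz0 qy y20) scaler0 subr0.
have [x20|x20] := eqVneq (x 0 2) 0.
  move: e => /rowP/(_ 2); rewrite !mxE x20 mulr0 mulVf // => /eqP.
  by rewrite eq_sym oner_eq0.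
have /lorentzP[x2 _] := qx; have /lorentzP[y2 _] := qy.
exists (x 0 2 / y 0 2).
  by rewrite divr_gt0 // lt_neqAle eq_sym ?x20 ?y20.
rewrite -scalerA -e scalerA divff // scale1r subrr.
by apply/lorentzP; rewrite /lorentz_disc !mxE !expr0n /= !subr0.
Qed.

Lemma face_label_neq x y : lorentz_cone x -> lorentz_cone y ->
  x != 0 -> y != 0 -> face_label x <> face_label y -> 0 < lorentz_disc (x + y).
Proof.
move=> qx qy x0 y0.
have /lorentzP[x2 dx] := qx; have /lorentzP[y2 dy] := qy.
have xy := lorentz_dot_ge0 qx qy.
rewrite -[x in x + y]scale1r -[y in _ + y]scale1r lorentz_disc_comb.
rewrite !expr1n !mul1r mulr1.
rewrite /face_label; case: ltP => dx'; first by lra.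
case: ltP => dy'; first by lra.
have x20 : x 0 2 != 0 by apply: contra_neq x0 => /(lorentz0 qx).
have y20 : y 0 2 != 0 by apply: contra_neq y0 => /(lorentz0 qy).
move=> ne; have := lorentz_dotE x y.
have -> : lorentz_disc x = 0 by apply/le_anti; rewrite dx dx'.
have -> : lorentz_disc y = 0 by apply/le_anti; rewrite dy dy'.
rewrite !mulr0 !addr0 add0r => e.
rewrite mulr_gt0 // lt_neqAle xy andbT eq_sym; apply: contra_notN ne => /eqP d0.
move: e; rewrite d0 mulr0 => /esym/eqP.
rewrite paddr_eq0 ?sqr_ge0 // !sqrf_eq0 !subr_eq0 => /andP[/eqP e0 /eqP e1].
congr Some; apply/rowP => i; rewrite !mxE ![_^-1 * _]mulrC.
by apply/eqP; rewrite eqr_div //; case: (ord3P i) => ->; rewrite ?e0 ?e1 // mulrC.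
Qed.

End Lorentz.

(** * Sequences in a power of the Lorentz cone *)

(** Infinite pigeonhole principle: some fibre of [f] in [A] is infinite, or [f]
    takes infinitely many values and one preimage of each is chosen. *)
Lemma infinite_cst_or_inj (I T : Type) (f : I -> T) (A : set I) :
  infinite_set A -> exists B : set I, [/\ B `<=` A, infinite_set B &
    (forall i j, B i -> B j -> f i = f j) \/
    (forall i j, B i -> B j -> f i = f j -> i = j)].
Proof.
move=> infA; have [fin|inf] := pselect (finite_set (f @` A)).
  have [y infy] : exists y, infinite_set (A `&` [set i | f i = y]).
    apply: contrapT => h; apply: infA.
    apply: (@sub_finite_set _ _
      (\bigcup_(y in f @` A) (A `&` [set i | f i = y]))).
      by move=> i Ai; exists (f i) => //; exists i.
    apply: bigcup_finite => // y _; apply: contrapT => hy.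
    by apply: h; exists y.
  exists (A `&` [set i | f i = y]); split=> //.
  by left=> i j [_ /= ->] [_ /= ->].
have /choice[g gP] : forall y, exists i, (f @` A) y -> A i /\ f i = y.
  move=> y; have [[i Ai <-]|ny] := pselect ((f @` A) y); first by exists i.
  have [i _] := infinite_setN0 infA.
  by exists i.
exists (g @` (f @` A)); split.
- by move=> _ [y yA <-]; have [] := gP y yA.
- move=> fin; apply: inf; apply: sub_finite_set (finite_image f fin).
  move=> y yA; exists (g y); first by exists y.
  by have [] := gP y yA.
- right=> _ _ [y yA <-] [z zA <-].
  by have [_ ->] := gP y yA; have [_ ->] := gP z zA => ->.
Qed.

Lemma infinite_distinct3 (I : choiceType) (A : set I) : infinite_set A ->
  exists i j l, [/\ A i, A j & A l] /\ [/\ i != j, i != l & j != l].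
Proof.
move=> inf; have [i Ai] := infinite_setN0 inf.
have infi : infinite_set (A `\ i) by apply: infinite_setD.
have [j [Aj /eqP ji]] := infinite_setN0 infi.
have infj : infinite_set (A `\ i `\ j) by apply: infinite_setD.
have [l [[Al /eqP li] /eqP lj]] := infinite_setN0 infj.
by exists i, j, l; split; split=> //; rewrite eq_sym.
Qed.

Section LorentzPower.
Variable R : realType.

Definition distinct3 (i j l : nat) := [&& i != j, i != l & j != l].

(** If the faces are all the same, [x l] already lies in the face of [x i].  If
    they are pairwise distinct, dropping the index with [x n = 0], if there is
    one, makes [x i + x j] an interior point. *)
Lemma lorentz_seq_face (x : nat -> 'rV[R]_3) (A : set nat) :
    (forall n, lorentz_cone (x n)) -> infinite_set A ->
  exists B : set nat, [/\ B `<=` A, infinite_set B &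
    forall i j l, B i -> B j -> B l -> distinct3 i j l ->
      face_le (x l) (x i + x j)].
Proof.
move=> qx infA.
have [B [BA infB [cst|inj]]] := infinite_cst_or_inj (fun n => face_label (x n)) infA.
  exists B; split=> // i j l Bi Bj Bl _.
  by apply: face_leDr => //; apply: face_label_eq => //; apply: cst.
have fin0 : finite_set (B `&` [set n | x n = 0]).
  have [[n0 [Bn0 /= xn0]]|h] := pselect ((B `&` [set n | x n = 0]) !=set0).
    apply: (@sub_finite_set _ _ [set n0]) => // n [Bn /= xn].
    by apply: inj => //=; rewrite xn xn0.
  by apply: (@sub_finite_set _ _ set0) => // n hn; case: h; exists n.
exists (B `\` (B `&` [set n | x n = 0])); split.
- by move=> n [/BA].
- exact: infinite_setD.
move=> i j l [Bi i0] [Bj j0] [Bl _] /and3P[ij _ _].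
have nz n : B n -> ~ (B `&` [set n | x n = 0]) n -> x n != 0.
  by move=> Bn h; apply/eqP => x0; apply: h.
apply: face_le_interior => //; first exact: lorentzD.
apply: face_label_neq => //; [exact: nz|exact: nz|].
by move=> /(inj _ _ Bi Bj)/eqP; rewrite (negbTE ij).
Qed.

Lemma face_le_shrink (x y : 'rV[R]_3) e d : lorentz_cone x ->
  lorentz_cone (x - e *: y) -> 0 < d -> d <= e -> lorentz_cone (x - d *: y).
Proof.
move=> qx qe d0 de; have e0 : 0 < e by apply: lt_le_trans de.
have -> : x - d *: y = (1 - d / e) *: x + (d / e) *: (x - e *: y).
  rewrite scalerBr scalerA divfK ?gt_eqF // addrA -scalerDl.
  by rewrite subrK scale1r.
apply: lorentz_comb => //; last by rewrite divr_ge0 // ltW.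
by rewrite subr_ge0 ler_pdivrMr // mul1r.
Qed.

Variable m : nat.

(** The infinite index set of [lorentz_seq_face] is refined once for each
    factor, and the finitely many coefficients obtained for one triple of
    indices are replaced by their minimum. *)
Lemma lorentz_pow_seq_face (x : nat -> {ffun 'I_m -> 'rV[R]_3}) :
  (forall n, lorentz_pow R m (x n)) -> exists i j l, distinct3 i j l /\
    exists2 e : R, 0 < e & lorentz_pow R m (x i + x j - e *: x l).
Proof.
move=> qx.
have [B [infB hB]] : exists B : set nat, infinite_set B /\
    forall k, k \in enum 'I_m -> forall i j l, B i -> B j -> B l ->
      distinct3 i j l -> face_le (x l k) (x i k + x j k).
  elim: (enum 'I_m) => [|k s [A [infA hA]]].
    by exists setT; split=> //; apply: infinite_nat.
  have [|B [BA infB hB]] := @lorentz_seq_face (x ^~ k) A _ infA.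
    by move=> n; apply: qx.
  exists B; split=> // k'; rewrite inE => /orP[/eqP ->|ks] i j l Bi Bj Bl.
    exact: hB.
  by apply: hA => //; apply: BA.
have [i [j [l [[Bi Bj Bl] [ij il jl]]]]] := infinite_distinct3 infB.
exists i, j, l; split; first by rewrite /distinct3 ij il jl.
have {}hB k : k \in enum 'I_m -> face_le (x l k) (x i k + x j k).
  by move=> /hB; apply=> //; rewrite /distinct3 ij il jl.
have qij k : lorentz_cone (x i k + x j k) by apply: lorentzD; apply: qx.
have [e e0 he] : exists2 e : R, 0 < e & forall k, k \in enum 'I_m ->
    lorentz_cone (x i k + x j k - e *: x l k).
  elim: (enum 'I_m) hB => [|k s IH] hB; first by exists 1.
  have [|e e0 he] := IH; first by move=> k' ks; apply: hB; rewrite inE ks orbT.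
  have [d d0 hd] := hB k (mem_head _ _).
  exists (Num.min e d); first by rewrite lt_min e0 d0.
  have min0 : 0 < Num.min e d by rewrite lt_min e0.
  move=> k'; rewrite inE => /orP[/eqP ->|ks].
    by apply: face_le_shrink hd _ _ => //; rewrite ge_min lexx orbT.
  by apply: face_le_shrink (he _ ks) _ _ => //; rewrite ge_min lexx.
by exists e => // k; rewrite !ffunE; apply: he; rewrite mem_enum.
Qed.

(** The obstruction to a lift: a linear section of the cone and a linear map
    preserve the relation found between the lifts of three points.  In
    particular [a l] lies in the face of [S] generated by [a i + a j], so a
    cone with infinitely many extreme rays, no three of which behave in this
    way, has no such lift. *)
Lemma lorentz_lift_seq (V : vectType R) (S : set V) (a : nat -> V) :
    has_lift (lorentz_pow R m) S -> (forall n, S (a n)) ->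
  exists i j l, distinct3 i j l /\
    exists2 e : R, 0 < e & S (a i + a j - e *: a l).
Proof.
move=> [T [L ->] [f ->]] Sa.
have /choice[x hx] : forall n, exists y,
    (lorentz_pow R m `&` [set` L]) y /\ f y = a n.
  by move=> n; have [y] := Sa n; exists y.
have [n|i [j [l [d [e e0 he]]]]] := @lorentz_pow_seq_face x.
  by have [[]] := hx n.
exists i, j, l; split=> //; exists e => //.
have xL n : x n \in L by have [[]] := hx n.
have fx n : f (x n) = a n by have [] := hx n.
exists (x i + x j - e *: x l); last by rewrite linearB linearD linearZ /= !fx.
by split=> //=; rewrite rpredB ?rpredD ?rpredZ.
Qed.

End LorentzPower.

(** * Rank-one elements of a slice *)

Section Rank1.
Variables (R : realType) (k : nat).
Implicit Types (A B : symmx R k) (v x : 'cV[R]_k).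

Lemma vsval_sym A : (vsval A)^T = vsval A.
Proof. exact/symvP/subvsP. Qed.

Lemma vsproj_sym (M : 'M[R]_k) : M^T = M -> vsval (vsproj (symv R k) M) = M.
Proof. by move=> sM; apply: vsprojK; apply/symvP. Qed.

Definition rank1 v : symmx R k := vsproj (symv R k) (v *m v^T).

Lemma vsval_rank1 v : vsval (rank1 v) = v *m v^T.
Proof. by apply: vsproj_sym; rewrite trmx_mul trmxK. Qed.

Lemma psd_orth_rank1 B v : bform (vsval B) v v = 0 -> psd_orth B (rank1 v).
Proof.
move=> v0; split; first by rewrite /psd_cone /= /is_psd vsval_rank1; exact: psdmx_rank1.
by rewrite /scalar_prod vsval_rank1 mxtrace_rank1.
Qed.

Lemma psdmx_rank1_sub u v w (e : R) x :
    psdmx (vsval (rank1 u + rank1 v - e *: rank1 w)) -> 0 < e ->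
    (x^T *m u) 0 0 = 0 -> (x^T *m v) 0 0 = 0 -> (x^T *m w) 0 0 = 0.
Proof.
move=> h e0 xu xv; have := h x.
have -> : vsval (rank1 u + rank1 v - e *: rank1 w) =
    u *m u^T + v *m v^T + (- e) *: (w *m w^T).
  by rewrite -scaleNr !linearD linearZ /= !vsval_rank1.
rewrite !bformDm bformZm !bform_rank1 xu xv !mulr0 !add0r mulNr oppr_ge0 pmulr_rle0 // => h1.
by apply/eqP; rewrite -sqrf_eq0 eq_le sqr_ge0 andbT.
Qed.

End Rank1.

(** * The nonsingular case *)

Section Nonsingular.
Variable R : realType.

(** Isotropic vectors of [hyperb c]; [chord c s t] is the linear form that
    vanishes on the points of parameters [s] and [t]. *)
Definition conic (c t : R) : 'cV[R]_3 :=
  \col_i [:: 1; - (c / 2) * t ^+ 2; t]`_i.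

Definition chord (c s t : R) : 'cV[R]_3 :=
  \col_i [:: s * t; - (2 / c); - (s + t)]`_i.

Lemma conic_isotropic c t : bform (hyperb c) (conic c t) (conic c t) = 0.
Proof. by rewrite bform_hyperb !mxE /=; field. Qed.

Lemma chord_conic c s t u : c != 0 ->
  ((chord c s t)^T *m conic c u) 0 0 = (u - s) * (u - t).
Proof. by move=> c0; rewrite mxE sum3 !mxE /=; field. Qed.

(** The lift would make a rank-one matrix of the conic dominated by the sum of
    two others, but evaluating at the chord through these two points gives a
    negative value. *)
Lemma nonsingular_no_lift (B : symmx R 3) (P : 'M[R]_3) c m :
    P \in unitmx -> P^T *m vsval B *m P = hyperb c -> c != 0 ->
  ~ has_lift (lorentz_pow R m) (psd_orth B).
Proof.
move=> uP hP c0 lift; pose v n := P *m conic c n%:R.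
have Sv n : psd_orth B (rank1 (v n)).
  by apply: psd_orth_rank1; rewrite -bform_congr hP conic_isotropic.
have [i [j [l [/and3P[_ il jl] [e e0 [pe _]]]]]] := lorentz_lift_seq lift Sv.
pose x := (invmx P)^T *m chord c i%:R j%:R.
have xv n : (x^T *m v n) 0 0 = (n%:R - i%:R) * (n%:R - j%:R).
  by rewrite trmx_mul trmxK -mulmxA mulKmx // chord_conic.
have := @psdmx_rank1_sub _ _ _ _ _ e x pe e0.
rewrite !xv !subrr mul0r mulr0 => /(_ erefl erefl)/eqP.
rewrite mulf_eq0 !subr_eq0 !eqr_nat.
by rewrite ![l == _]eq_sym (negbTE il) (negbTE jl).
Qed.

End Nonsingular.

(** * The singular case *)

Section Singular.
Variables (R : realType) (P : 'M[R]_3).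

(** The symmetric matrices supported on the path [0 - 2 - 1]. *)
Definition arrow (a b c d e : R) : 'M[R]_3 :=
  \matrix_(i, j) (nth [::] [:: [:: a; 0; c]; [:: 0; b; d]; [:: c; d; e]] i)`_j.

Lemma bform_arrow a b c d e x : bform (arrow a b c d e) x x =
  a * x 0 0 ^+ 2 + b * x 1 0 ^+ 2 + e * x 2 0 ^+ 2
  + 2 * c * x 0 0 * x 2 0 + 2 * d * x 1 0 * x 2 0.
Proof. by rewrite /bform mxE !sum3 !mxE !sum3 !mxE /=; ring. Qed.

Lemma arrow_sym a b c d e : (arrow a b c d e)^T = arrow a b c d e.
Proof.
by apply/matrixP => i j; rewrite !mxE; case: (ord3P i) => ->; case: (ord3P j) => ->.
Qed.

(** [e1] is the least value that makes the block of [a], [c], [e1] positive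
    semidefinite.  The remaining block is then the Schur complement of [a] in
    the arrow matrix: minimizing over the first coordinate gives the vector
    [(- (c / a) * t, s, t)].  For [a = 0] also [c = 0], and division by zero
    gives [e1 = 0], which is the right value. *)
Lemma psdmx_arrow_split a b c d e : psdmx (arrow a b c d e) ->
  exists e1, [/\ [/\ 0 <= a, 0 <= e1 & c ^+ 2 <= a * e1] &
     [/\ 0 <= b, 0 <= e - e1 & d ^+ 2 <= b * (e - e1)]].
Proof.
move=> h; exists (c ^+ 2 / a).
have [] : [/\ 0 <= a, 0 <= e & c ^+ 2 <= a * e].
  apply: quad_ge0 => s t; have := h (\col_i [:: s; 0; t]`_i).
  by rewrite bform_arrow !mxE /=; congr (_ <= _); ring.
move=> a0 e0 ce; split.
  split=> //; first by rewrite mulr_ge0 ?sqr_ge0 ?invr_ge0.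
  have [az|an] := eqVneq a 0; first by move: ce; rewrite az !mul0r.
  by rewrite mulrC divfK.
apply: quad_ge0 => s t; have := h (\col_i [:: - (c / a) * t; s; t]`_i).
rewrite bform_arrow !mxE /=; congr (_ <= _).
have [az|an] := eqVneq a 0; last by field.
move: ce; rewrite az !mul0r => c2.
have -> : c = 0 by apply/eqP; rewrite -sqrf_eq0 eq_le c2 sqr_ge0.
ring.
Qed.

(** [(x0, x1, x2)] in the Lorentz cone corresponds to the positive semidefinite
    block with diagonal [x2 + x0], [x2 - x0] and off-diagonal entry [x1]; the
    two blocks of [f] overlap in the last diagonal entry. *)
Definition glue (f : {ffun 'I_2 -> 'rV[R]_3}) : 'M[R]_3 :=
  arrow (f 0 0 2 + f 0 0 0) (f 1 0 2 + f 1 0 0) (f 0 0 1) (f 1 0 1)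
        (f 0 0 2 - f 0 0 0 + (f 1 0 2 - f 1 0 0)).

Lemma glue_is_linear : linear glue.
Proof.
move=> a f g; apply/matrixP => i j; rewrite !mxE !ffunE !mxE.
by case: (ord3P i) => ->; case: (ord3P j) => -> /=; ring.
Qed.

Lemma lorentz_quad_ge0 (z : 'rV[R]_3) s t : lorentz_cone z ->
  0 <= (z 0 2 + z 0 0) * s ^+ 2 + 2 * z 0 1 * s * t
       + (z 0 2 - z 0 0) * t ^+ 2.
Proof.
move=> /lorentzP[z2]; rewrite /lorentz_disc => dz.
have h0 : 0 <= z 0 1 ^+ 2 by apply: sqr_ge0.
have /andP[l r] : - z 0 2 <= z 0 0 <= z 0 2.
  by rewrite -ler_norml -ler_sqr ?nnegrE // real_normK ?num_real //; lra.
apply: quad_form_ge0; [lra|lra|].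
have -> : (z 0 2 + z 0 0) * (z 0 2 - z 0 0) = z 0 2 ^+ 2 - z 0 0 ^+ 2 by ring.
lra.
Qed.

Lemma lorentz_of_quad (a b c : R) : 0 <= a -> 0 <= c -> b ^+ 2 <= a * c ->
  lorentz_cone (\row_i [:: (a - c) / 2; b; (a + c) / 2]`_i : 'rV[R]_3).
Proof.
move=> a0 c0 h; apply/lorentzP; rewrite /lorentz_disc !mxE /=.
split; first by lra.
have -> : ((a + c) / 2) ^+ 2 - ((a - c) / 2) ^+ 2 - b ^+ 2 = a * c - b ^+ 2.
  by field.
by rewrite subr_ge0.
Qed.

Lemma psdmx_glue f : lorentz_pow R 2 f -> psdmx (glue f).
Proof.
move=> q x; rewrite bform_arrow.
have := lorentz_quad_ge0 (x 0 0) (x 2 0) (q 0).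
have := lorentz_quad_ge0 (x 1 0) (x 2 0) (q 1).
lra.
Qed.

Definition glueP (f : {ffun 'I_2 -> 'rV[R]_3}) : symmx R 3 :=
  vsproj (symv R 3) (P *m glue f *m P^T).

Lemma glueP_is_linear : linear glueP.
Proof.
move=> a f g; rewrite /glueP glue_is_linear mulmxDr mulmxDl.
by rewrite -scalemxAr -scalemxAl linearP.
Qed.

HB.instance Definition _ := GRing.isLinear.Build R
  {ffun 'I_2 -> 'rV[R]_3} (symmx R 3) _ glueP glueP_is_linear.

Lemma vsval_glueP f : vsval (glueP f) = P *m glue f *m P^T.
Proof.
by apply: vsproj_sym; rewrite !trmx_mul trmxK arrow_sym mulmxA.
Qed.

Lemma orth_arrow (N B : 'M[R]_3) : N^T = N -> P^T *m B *m P = hyperb 0 ->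
    \tr (P *m N *m P^T *m B) = 0 ->
  N = arrow (N 0 0) (N 1 1) (N 0 2) (N 1 2) (N 2 2).
Proof.
move=> sN hP; rewrite mxtrace_congr hP mxtrace_hyperb mul0r addr0.
have sE i j : N i j = N j i by rewrite -{1}sN mxE.
rewrite (sE 1 0) => N2; have N01 : N 0 1 = 0 by lra.
apply/matrixP => i j; rewrite [RHS]mxE.
by case: (ord3P i) => ->; case: (ord3P j) => -> //=; rewrite sE.
Qed.

(** Splitting the corner of [N] provides the points of the two cones. *)
Lemma singular_lift (B : symmx R 3) : P \in unitmx ->
    P^T *m vsval B *m P = hyperb 0 ->
  has_lift (lorentz_pow R 2) (psd_orth B).
Proof.
move=> uP hP; exists (lorentz_pow R 2).
  exists fullv; apply/seteqP; split=> [f qf|f []//].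
  by split=> //=; rewrite memvf.
exists (linfun glueP); apply/seteqP; split=> [A [pA tA]|_ [f qf <-]]; last first.
  rewrite lfunE /=; split.
    move=> x; rewrite vsval_glueP -[P in P *m glue f]trmxK.
    by rewrite -/(bform _ x x) bform_congr; apply: psdmx_glue.
  rewrite /scalar_prod vsval_glueP mxtrace_congr hP.
  by rewrite mxtrace_hyperb !mxE /= mul0r !addr0.
pose A' := invmx P *m vsval A *m (invmx P)^T.
have AE : vsval A = P *m A' *m P^T by apply: mulmx_congrK.
have sA' : A'^T = A' by rewrite !trmx_mul trmxK vsval_sym mulmxA.
have A'E : A' = arrow (A' 0 0) (A' 1 1) (A' 0 2) (A' 1 2) (A' 2 2).
  by apply: orth_arrow sA' hP _; rewrite -AE.
have pA' : psdmx A'.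
  by move=> x; rewrite /A' -[X in X *m _ *m _]trmxK bform_congr; apply: pA.
move: pA'; rewrite {1}A'E => /psdmx_arrow_split[e1 [[a0 e10 h1] [b0 e20 h2]]].
pose f : {ffun 'I_2 -> 'rV[R]_3} := [ffun k => if k == 0
  then \row_i [:: (A' 0 0 - e1) / 2; A' 0 2; (A' 0 0 + e1) / 2]`_i
  else \row_i [:: (A' 1 1 - (A' 2 2 - e1)) / 2; A' 1 2;
                  (A' 1 1 + (A' 2 2 - e1)) / 2]`_i].
exists f.
  by move=> k; rewrite ffunE; case: eqP => _; apply: lorentz_of_quad.
apply: val_inj; rewrite lfunE /= vsval_glueP AE; congr (_ *m _ *m _).
by rewrite A'E /glue !ffunE !mxE /=; congr arrow; field.
Qed.

End Singular.

(** * Slices are closed convex cones *)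

Section Topology.
Variable R : realType.

Lemma rowv_linear_continuous (n : nat) (phi : 'rV[R]_n -> R^o) :
  linear phi -> continuous phi.
Proof.
move=> lphi.
pose F : {linear 'rV[R]_n -> R^o} :=
  HB.pack phi (GRing.isLinear.Build R 'rV[R]_n R^o _ phi lphi).
have -> : phi = (fun r => \sum_(j <- index_enum 'I_n) r 0 j * F (delta_mx 0 j)).
  apply/funext => r; rewrite -[phi]/(F : _ -> _) {1}(row_sum_delta r) linear_sum.
  by apply: eq_bigr => j _; rewrite linearZ.
apply: continuous_big => [|j _]; first exact: add_continuous.
move=> r; apply: (@cvgM R _ (nbhs r)); first exact: coord_continuous.
exact: cvg_cst.
Qed.

(** The slice is an intersection of preimages of closed sets under the linear
    functions [A |-> bform A x x] and [A |-> scalar_prod A B]. *)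
Lemma closed_psd_orth (k : nat) (B : symmx R k) : closed_vect (psd_orth B).
Proof.
rewrite /closed_vect.
have -> : [set v2r x | x in psd_orth B] =
   (\bigcap_(x in [set: 'cV[R]_k]) ((fun r : 'rV[R]__ =>
       bform (vsval (r2v r : symmx R k)) x x)
         @^-1` [set y | 0 <= y])) `&`
   ((fun r : 'rV[R]__ => scalar_prod (r2v r) B)
         @^-1` [set y | y = 0]).
  apply/seteqP; split=> [_ [A [pA tA] <-]|r [pr tr]].
    by split=> /= [x _ /=|]; rewrite v2rK //; apply: pA.
  exists (r2v r); last exact: r2vK.
  by split=> // x; apply: pr.
apply: closedI.
  apply: closed_bigI => x _; apply: preimage_closed; last exact: closed_ge.
  move=> r _; apply: rowv_linear_continuous => a u v.
  by rewrite /= !linearD !linearZ bformDm bformZm.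
apply: preimage_closed; last exact: closed_eq.
move=> r _; apply: rowv_linear_continuous => a u v.
by rewrite /scalar_prod !linearD !linearZ /= mulmxDl -scalemxAl linearD linearZ.
Qed.

Lemma convex_cone_psd_orth (k : nat) (B : symmx R k) :
  convex_cone (psd_orth B).
Proof.
split.
  exists 0; split; first by move=> x; rewrite [vsval _]linear0 mulmx0 mul0mx mxE.
  by rewrite /scalar_prod [vsval _]linear0 mul0mx linear0.
move=> a b A C a0 b0 [pA tA] [pC tC].
have E : vsval (a *: A + b *: C) = a *: vsval A + b *: vsval C.
  by rewrite linearD !linearZ.
split; first by move=> x; rewrite E; apply: psdmx_comb.
move: tA tC; rewrite /scalar_prod E mulmxDl -!scalemxAl linearD !linearZ /=.
by move=> -> ->; rewrite !mulr0 addr0.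
Qed.

End Topology.

(** * Dimensions *)

Section Dimensions.
Variable R : realType.
Implicit Types (A B : symmx R 3).

(** Coordinates on the symmetric matrices: the diagonal entries, then the
    entries above it. *)
Definition sym6 (r : 'rV[R]_6) : 'M[R]_3 :=
  \matrix_(i, j) r 0 (nth [::] [:: [:: 0; 3; 4]; [:: 3; 1; 5]; [:: 4; 5; 2]] i)`_j.

Definition symmx_of_row (r : 'rV[R]_6) : symmx R 3 := vsproj (symv R 3) (sym6 r).

Lemma vsval_symmx_of_row r : vsval (symmx_of_row r) = sym6 r.
Proof.
apply: vsproj_sym; apply/matrixP => i j; rewrite !mxE.
by case: (ord3P i) => ->; case: (ord3P j) => ->.
Qed.

Lemma symmx_of_row_is_linear : linear symmx_of_row.
Proof.
move=> a r s; apply: val_inj; rewrite linearP /= !vsval_symmx_of_row.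
by apply/matrixP => i j; rewrite !mxE.
Qed.

HB.instance Definition _ := GRing.isLinear.Build R 'rV[R]_6 (symmx R 3) _
  symmx_of_row symmx_of_row_is_linear.

Lemma dim_symmx3 : \dim {:symmx R 3} = 6%N.
Proof.
have <- : limg (linfun symmx_of_row) = fullv.
  apply/vspaceP => A; rewrite memvf; apply/memv_imgP.
  pose M := vsval A.
  exists (\row_i [:: M 0 0; M 1 1; M 2 2; M 0 1; M 0 2; M 1 2]`_i).
    exact: memvf.
  have sE i j : M i j = M j i by rewrite /M -{1}vsval_sym mxE.
  apply: val_inj; rewrite lfunE /= vsval_symmx_of_row -/M.
  apply/matrixP => i j; rewrite !mxE.
  by case: (ord3P i) => ->; case: (ord3P j) => -> //=; rewrite sE.
rewrite limg_dim_eq ?dimvf ?dim_matrix //; apply/eqP; rewrite capfv.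
apply/lker0P => r s; rewrite !lfunE /= => /(congr1 vsval).
rewrite !vsval_symmx_of_row => /matrixP e; apply/rowP => i.
have := e 0 0; have := e 1 1; have := e 2 2.
have := e 0 1; have := e 0 2; have := e 1 2; rewrite !mxE /=.
case: i => [[|[|[|[|[|[|//]]]]]] hi] e1 e2 e3 e4 e5 e6;
  [move: e6|move: e5|move: e4|move: e3|move: e2|move: e1];
  by congr (_ = _); congr (_ _ _); apply: val_inj.
Qed.

Definition sdot B A : R^o := scalar_prod A B.

Lemma sdot_is_linear B : linear (sdot B).
Proof.
move=> a A C; rewrite /sdot /scalar_prod.
have -> : vsval (a *: A + C) = a *: vsval A + vsval C by rewrite linearP.
by rewrite mulmxDl -scalemxAl linearP.
Qed.

HB.instance Definition _ B := GRing.isLinear.Build R (symmx R 3) R^o _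
  (sdot B) (sdot_is_linear B).

Definition orthv B : {vspace symmx R 3} := lker (linfun (sdot B)).

Lemma mem_orthv B A : (A \in orthv B) = (scalar_prod A B == 0).
Proof. by rewrite memv_ker lfunE. Qed.

Lemma psd_orthE B : psd_orth B = @psd_cone R 3 `&` [set` orthv B].
Proof.
apply/seteqP; split=> A [pA] /=; rewrite mem_orthv; first by move/eqP.
by move/eqP.
Qed.

Lemma scalar_prod_gt0 B : B != 0 -> 0 < scalar_prod B B.
Proof.
move=> B0; rewrite /scalar_prod /mxtrace.
have E i : (vsval B *m vsval B) i i = \sum_j vsval B i j ^+ 2.
  rewrite mxE; apply: eq_bigr => j _; rewrite expr2; congr (_ * _).
  by rewrite -{1}vsval_sym mxE.
have ge0 i : 0 <= (vsval B *m vsval B) i i.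
  by rewrite E; apply: sumr_ge0 => j _; apply: sqr_ge0.
rewrite lt_neqAle sumr_ge0 // andbT eq_sym; apply: contra B0.
rewrite psumr_eq0 // => /allP h; apply/eqP/subvs_inj/matrixP => i j.
have := h i (mem_index_enum _); rewrite /= E psumr_eq0; last first.
  by move=> l _; apply: sqr_ge0.
move=> /allP/(_ j (mem_index_enum _)); rewrite /= sqrf_eq0 => /eqP ->.
by rewrite mxE.
Qed.

Lemma dim_orthv B : B != 0 -> \dim (orthv B) = 5%N.
Proof.
move=> B0; have := limg_ker_dim (linfun (sdot B)) fullv.
rewrite capfv dim_symmx3 -/(orthv B).
have -> : \dim (limg (linfun (sdot B))) = 1%N; last by rewrite addn1 => -[].
have -> : limg (linfun (sdot B)) = fullv.
  apply/vspaceP => x; rewrite memvf; apply/memv_imgP.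
  exists ((x / scalar_prod B B) *: B); first exact: memvf.
  rewrite lfunE /= linearZ /=; apply/esym/divfK.
  by rewrite gt_eqF // scalar_prod_gt0.
by rewrite dimvf.
Qed.

(** Pairing with the 5 elements of a basis of [U] is a linear map from dimension
    6 to dimension 5; [B] is a nonzero element of its kernel. *)
Lemma hyperplane_orthv (U : {vspace symmx R 3}) : \dim U = 5%N ->
  exists2 B, B != 0 & U = orthv B.
Proof.
move=> dU; pose X := vbasis U.
pose G (B : symmx R 3) : 'rV[R]_5 := \row_(i < 5) scalar_prod B X`_i.
have lG : linear G.
  move=> a A C; apply/rowP => i; rewrite !mxE.
  exact: (linearP (sdot X`_i) a A C).
pose F : {linear symmx R 3 -> 'rV[R]_5} :=
  HB.pack G (GRing.isLinear.Build R (symmx R 3) 'rV[R]_5 _ G lG).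
have K0 : lker (linfun F) != 0%VS.
  apply/eqP => K0; have := limg_ker_dim (linfun F) fullv.
  rewrite K0 capv0 dimv0 add0n dim_symmx3 => d6.
  by have := dimvS (subvf (limg (linfun F))); rewrite d6 dimvf dim_matrix.
have B0 : vpick (lker (linfun F)) != 0 by rewrite vpick0.
exists (vpick (lker (linfun F))) => //.
apply/eqP; rewrite eqEdim dU dim_orthv // andbT.
rewrite -(span_basis (vbasisP U)); apply/span_subvP => Y /(nthP 0)[i].
rewrite size_tuple => idU <-.
have i5 : (i < 5)%N by rewrite -dU.
have := memv_pick (lker (linfun F)); rewrite memv_ker lfunE /= => /eqP/rowP.
move=> /(_ (Ordinal i5)); rewrite !mxE /= mem_orthv => h.
by rewrite /scalar_prod mxtrace_mulC; apply/eqP.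
Qed.

Lemma sym_mulmx_onto (k : nat) (q y : 'cV[R]_k) : (q^T *m q) 0 0 != 0 ->
  exists2 M : 'M[R]_k, M^T = M & M *m q = y.
Proof.
move=> qq; pose s := (q^T *m q) 0 0; pose t := (q^T *m y) 0 0.
have sE : q^T *m q = s%:M by apply: mx11_scalar.
have tE : y^T *m q = t%:M.
  rewrite [LHS]mx11_scalar; congr (_%:M).
  by rewrite /t -[y in RHS]trmxK -trmx_mul [RHS]mxE.
exists (s^-1 *: (y *m q^T + q *m y^T - (t / s) *: (q *m q^T))).
  rewrite linearZ; congr (_ *: _); rewrite /= linearB linearD linearZ /=.
  by rewrite !trmx_mul !trmxK [q *m _ + _]addrC.
rewrite -scalemxAl mulmxBl mulmxDl -scalemxAl -!mulmxA sE tE.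
rewrite !mul_mx_scalar scalerA divfK // addrK scalerA mulVf //.
by rewrite scale1r.
Qed.

(** All [A] in the slice annihilate [q = B *m p], where [p] is not isotropic.
    Since [A |-> A *m q] maps the symmetric matrices onto the vectors, this
    leaves a hull of dimension at most [6 - 3]. *)
Lemma psd_hull_dim B : B != 0 -> is_psd B -> ~ has_dim (psd_orth B) 5.
Proof.
move=> B0 pB [U [_ hU] dU].
have [p pp] : exists p, 0 < bform (vsval B) p p.
  apply: contrapT => h; move/eqP: B0; apply.
  apply: subvs_inj; rewrite [RHS]linear0; apply/matrixP => i j.
  have : vsval B *m (delta_mx j 0 : 'cV_3) = 0; last first.
    by move=> /matrixP/(_ i 0); rewrite -colE !mxE.
  apply: psdmx_ker => //; first exact: vsval_sym.
  apply/eqP; rewrite eq_le pB andbT leNgt; apply/negP => hp.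
  by apply: h; exists (delta_mx j 0).
pose q := vsval B *m p.
have qq : (q^T *m q) 0 0 != 0.
  apply: contraL pp => /eqP q0.
  have : q = 0.
    apply/colP => i; rewrite [RHS]mxE; move: q0; rewrite mxE => /eqP.
    under eq_bigr do rewrite mxE -expr2.
    rewrite psumr_eq0; last by move=> j _; apply: sqr_ge0.
    by move=> /allP/(_ i (mem_index_enum _)); rewrite /= sqrf_eq0 => /eqP.
  by move=> q1; rewrite /bform -mulmxA -/q q1 mulmx0 mxE ltxx.
pose F := linfun (mulmxr q \o @vsval _ _ (symv R 3)).
have FE A : F A = vsval A *m q by rewrite lfunE.
have UK : (U <= lker F)%VS.
  apply: hU => A [pA tA] /=; rewrite memv_ker FE; apply/eqP.
  by apply: psdmx_orth_ker => //; apply: vsval_sym.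
have := dimvS UK; have := limg_ker_dim F fullv.
rewrite capfv dim_symmx3 dU.
suff -> : limg F = fullv.
  by rewrite dimvf => h; rewrite -(leq_add2r 3) h.
apply/vspaceP => y; rewrite memvf; apply/memv_imgP.
have [M sM <-] := sym_mulmx_onto y qq.
exists (vsproj (symv R 3) M); first exact: memvf.
by rewrite FE vsproj_sym.
Qed.

End Dimensions.

Section Hull.
Variable R : realType.

Definition col3 (a b c : R) : 'cV[R]_3 := \col_i [:: a; b; c]`_i.

(** The five vectors satisfy [x0 * x1 = 0], so that they are isotropic for
    [hyperb 0]. *)
Lemma arrow_rank1 (a b c d e : R) : arrow a b c d e =
  (a - c) *: (col3 1 0 0 *m (col3 1 0 0)^T)
  + (b - d) *: (col3 0 1 0 *m (col3 0 1 0)^T)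
  + (e - c - d) *: (col3 0 0 1 *m (col3 0 0 1)^T)
  + c *: (col3 1 0 1 *m (col3 1 0 1)^T)
  + d *: (col3 0 1 1 *m (col3 0 1 1)^T).
Proof.
apply/matrixP => i j; rewrite !mxE !big_ord1 !mxE.
by case: (ord3P i) => ->; case: (ord3P j) => -> /=; ring.
Qed.

Lemma singular_hull (B : symmx R 3) (P : 'M[R]_3) : P \in unitmx ->
    P^T *m vsval B *m P = hyperb 0 ->
  is_linear_hull (psd_orth B) (orthv B).
Proof.
move=> uP hP; split; first by rewrite psd_orthE => A [].
move=> W SW; apply/subvP => A; rewrite mem_orthv => /eqP tA.
pose A' := invmx P *m vsval A *m (invmx P)^T.
have AE : vsval A = P *m A' *m P^T by apply: mulmx_congrK.
have sA' : A'^T = A' by rewrite !trmx_mul trmxK vsval_sym mulmxA.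
have A'E : A' = arrow (A' 0 0) (A' 1 1) (A' 0 2) (A' 1 2) (A' 2 2).
  by apply: orth_arrow sA' hP _; rewrite -AE.
have WP (x y z : R) : x * y = 0 -> rank1 (P *m col3 x y z) \in W.
  move=> xy; apply: SW; apply: psd_orth_rank1.
  by rewrite -bform_congr hP bform_hyperb !mxE /= mul0r [y * x]mulrC xy !addr0.
have PE v : vsval (rank1 (P *m v)) = P *m (v *m v^T) *m P^T.
  by rewrite vsval_rank1 trmx_mul !mulmxA.
have -> : A = (A' 0 0 - A' 0 2) *: rank1 (P *m col3 1 0 0)
  + (A' 1 1 - A' 1 2) *: rank1 (P *m col3 0 1 0)
  + (A' 2 2 - A' 0 2 - A' 1 2) *: rank1 (P *m col3 0 0 1)
  + A' 0 2 *: rank1 (P *m col3 1 0 1)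
  + A' 1 2 *: rank1 (P *m col3 0 1 1).
  apply: subvs_inj; rewrite AE {1}A'E arrow_rank1 !mulmxDr !mulmxDl.
  by rewrite -!scalemxAr -!scalemxAl -!PE !linearD !linearZ.
by rewrite !rpredD ?rpredZ ?WP ?mul0r ?mulr0.
Qed.

End Hull.

Lemma dim_psd_orth_singular (R : realType) (B : symmx R 3) (P : 'M[R]_3) :
    P \in unitmx -> P^T *m vsval B *m P = hyperb 0 -> B != 0 ->
  has_dim (psd_orth B) 5.
Proof.
by move=> uP hP B0; exists (orthv B); [apply: singular_hull hP|apply: dim_orthv].
Qed.

Lemma indefinite_nz (R : realType) (k : nat) (B : symmx R k) :
  indefinite B -> B != 0.
Proof.
case=> npB _; apply: contra_notN npB => /eqP -> x.
by rewrite [vsval _]linear0 mulmx0 mul0mx mxE.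
Qed.

Lemma symmx_normal_form (R : realType) (B : symmx R 3) : indefinite B ->
  exists2 P : 'M[R]_3, P \in unitmx &
    exists c, P^T *m vsval B *m P = hyperb c.
Proof.
case=> /existsNP[q /negP qq] /existsNP[p /negP pp].
by apply: (@indefinite_normal_form R _ p q); rewrite ?vsval_sym // ltNge.
Qed.

Lemma psd_orthN (R : realType) (k : nat) (B : symmx R k) :
  psd_orth (- B) = psd_orth B.
Proof.
have E A : scalar_prod A (- B) = - scalar_prod A B.
  by rewrite /scalar_prod [vsval (- B)]linearN mulmxN linearN.
apply/seteqP; split=> A [pA tA]; split=> //.
  by apply/eqP; rewrite -oppr_eq0 -E tA.
by rewrite E tA oppr0.
Qed.

(** A slice is cut out by its own linear hull, here a hyperplane. *)
Lemma slice_dim5 (R : realType) (S : set (symmx R 3)) :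
    is_slice (@psd_cone R 3) S -> has_dim S 5 ->
  exists2 B, indefinite B & S = psd_orth B.
Proof.
move=> [L SE] dS; have [U [SU hU] dU] := dS.
have [B B0 UE] := hyperplane_orthv dU.
have SB : S = psd_orth B.
  rewrite psd_orthE -UE; apply/seteqP; split=> A.
    by move=> SA; split; [move: SA; rewrite SE => -[]|apply: SU].
  case=> pA UA; rewrite SE; split=> //=; apply: (subvP _ _ UA).
  by apply: hU; rewrite SE => ? [].
exists B => //; split=> hB; move: dS; rewrite SB; first exact: psd_hull_dim.
rewrite -psd_orthN; apply: psd_hull_dim; first by rewrite oppr_eq0.
move=> x; rewrite [vsval _]linearN mulmxN mulNmx mxE oppr_ge0; exact: hB.
Qed.

Theorem corollary1 (R : realType) :
  [set psd_orth B | B in [set B : symmx R 3 | singular B /\ indefinite B]] =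
  [set S : set (symmx R 3) |
    [/\ is_slice (@psd_cone R 3) S, has_dim S 5 & is_socr S]].
Proof.
apply/seteqP; split=> [_ [B [sB iB] <-]|S [slS dS [_ _ [m _ lift]]]].
  have [P uP [c hP]] := symmx_normal_form iB.
  have c0 : c = 0.
    by apply: contraNeq sB => c0; rewrite (normal_form_unit uP hP).
  rewrite c0 in hP; split.
  - by exists (orthv B); apply: psd_orthE.
  - by apply: dim_psd_orth_singular hP _ => //; apply: indefinite_nz.
  - split; [exact: convex_cone_psd_orth|exact: closed_psd_orth|].
    by exists 2%N => //; apply: singular_lift hP.
have [B iB SB] := slice_dim5 slS dS.
exists B => //; split=> //; have [P uP [c hP]] := symmx_normal_form iB.
rewrite /singular (normal_form_unit uP hP); apply/negP => c0.
by apply: (nonsingular_no_lift uP hP c0 (m := m)); rewrite -SB.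
Qed.
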